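(* Let $\Gamma_{\mathbb R}=\mathbf{c}^{-1}(\mathrm{SO}_3(\mathbb{Z}[i]))\cap \mathrm{SL}_2(\mathbb{R})$ (this is the group $\mathbf c^{-1}(\Gamma_{\mathbb Z})$), acting on $\mathbb{H}^2$ by fractional linear transformations. (a) The stabilizer of the height function is $\{\gamma\in\Gamma_{\mathbb R}: y(\gamma z)=y(z)\ \forall z\in\mathbb{H}^2\}=\pm\begin{pmatrix}1&2\mathbb{Z}\\0&1\end{pmatrix}$. (b) The interval $\mathcal{G}_{\mathbb R}:=[0,2]$ is a fundamental domain for the action on $\mathbb{R}$ induced by this stabilizer, and $\mathcal{G}_{\mathbb R}=\overline{\mathrm{Int}\,\mathcal{G}_{\mathbb R}}$. (c) Let $\mathcal F_{1,\mathbb R}=\{z\in\mathbb{H}^2: y(z)\ge y(\gamma z)\ \forall\gamma\in\Gamma_{\mathbb R}\}$ and $\mathcal F_{\mathbb R}(\mathcal G_{\mathbb R})=\{z\in\mathcal F_{1,\mathbb R}: x(z)\in\mathcal G_{\mathbb R}\}$. Then $$\mathcal F_{\mathbb R}(\mathcal G_{\mathbb R})=\{z\in\mathbb{H}^2: 0\le x(z)\le 2,\ y(z)^2+(x(z)-1)^2\ge 2\}=\mathscr{C}_{\mathbf H}(i,\,2+i,\,\infty).$$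
   Context: $\mathbb{H}^2$ is the upper half-plane, $z=x(z)+i\,y(z)$, with the hyperbolic metric. For $g\in \mathrm{SL}_2(\mathbb{C})$, $\mathbf{c}(g)$ is the matrix of $X\mapsto gXg^{-1}$ on $\mathfrak{sl}_2(\mathbb{C})$ with respect to the basis $X_1=\begin{pmatrix}0&1\\1&0\end{pmatrix}$, $X_2=\begin{pmatrix}0&i\\-i&0\end{pmatrix}$, $Y=\begin{pmatrix}1&0\\0&-1\end{pmatrix}$, orthonormal for $\frac12\mathrm{Tr}(XY)$; $\mathbf c:\mathrm{SL}_2(\mathbb{C})\to\mathrm{SO}_3(\mathbb{C})$ is surjective with kernel $\{\pm I\}$. $\mathrm{SO}_3(\mathbb{Z}[i])$ is the subgroup of $\mathrm{SO}_3(\mathbb{C})$ of matrices with entries in $\mathbb{Z}[i]$. Fundamental domain: if a group $\Delta$ acts on a topological space $X$, $\mathcal F\subseteq X$ is a fundamental domain if $X=\Delta\mathcal F$ and for $\gamma_1\neq\gamma_2$ in $\Delta$, $\gamma_1\mathcal F\cap\gamma_2\mathcal F$ is contained in both $\gamma_1\partial\mathcal F$ and $\gamma_2\partial\mathcal F$; here groups are taken modulo $\pm I$, which acts trivially. The stabilizer of the height acts on $\mathbb{R}$ through the coordinate $x(z)$. $\mathscr{C}_{\mathbf H}(p_1,\dots,p_r)$ is the smallest geodesically convex subset of $\overline{\mathbb{H}^2}=\mathbb{H}^2\cup\mathbb{R}\cup\{\infty\}$ containing the points; the equality is understood in $\mathbb{H}^2$, i.e. up to the ideal point $\infty$. *)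

(* Defs.v *)
From HB Require Import structures.
From mathcomp Require Import all_boot all_order all_algebra.
From mathcomp Require Import all_classical all_reals all_analysis.
From mathcomp Require Import complex ring lra.
Set Implicit Arguments.
Unset Strict Implicit.
Unset Printing Implicit Defensive.
Import Order.TTheory GRing.Theory Num.Theory.
Import numFieldNormedType.Exports.
Local Open Scope classical_set_scope.
Local Open Scope ring_scope.
Local Open Scope complex_scope.

(* Num.Theory shadows the real-valued projections of R[i]. *)
Local Notation Re := complex.Re.
Local Notation Im := complex.Im.

Definition mx2 (K : nzRingType) (a b c d : K) : 'M[K]_2 :=
  \matrix_(i, j) nth 0 (nth [::] [:: [:: a; b]; [:: c; d]] i) j.

Definition SL2 (K : comNzRingType) : set 'M[K]_2 := [set g | \det g = 1].

Section adjoint_representation.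
Variable R : realType.
Local Notation C := R[i].

Definition sl2_basis : 3.-tuple 'M[C]_2 :=
  [tuple mx2 0 1 1 0; mx2 0 'i%C (- 'i%C) 0; mx2 1 0 0 (-1)].

(* Column j holds the coordinates of the image of the j-th basis vector. *)
Definition conj_mx (g : 'M[C]_2) : 'M[C]_3 :=
  \matrix_(i, j) coord sl2_basis i (g *m tnth sl2_basis j *m invmx g).

Definition SO3 : set 'M[C]_3 := [set A | A^T *m A = 1%:M /\ \det A = 1].

Definition gaussian_integers : set C :=
  [set z | exists m n : int, z = m%:~R +i* n%:~R].

Definition SO3_gaussian : set 'M[C]_3 :=
  [set A | SO3 A /\ forall i j, gaussian_integers (A i j)].

Definition Gamma_R : set 'M[R]_2 :=
  [set g | SL2 g /\
     (@SL2 C `&` conj_mx @^-1` SO3_gaussian) (map_mx (real_complex R) g)].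

End adjoint_representation.

Section upper_half_plane.
Variable R : realType.
Local Notation C := R[i].

Definition H2 : set C := [set z | 0 < Im z].

Definition mobius (g : 'M[R]_2) (z : C) : C :=
  ((g 0 0)%:C * z + (g 0 1)%:C) / ((g 1 0)%:C * z + (g 1 1)%:C).

Definition height_stabilizer : set 'M[R]_2 :=
  [set g | Gamma_R g /\ forall z, H2 z -> Im (mobius g z) = Im z].

(* The height 1 of the lift x + i of x is irrelevant on height_stabilizer:
   see induced_actE. *)
Definition induced_act (g : 'M[R]_2) (x : R) : R := Re (mobius g (x +i* 1)).

Definition F1_R : set C :=
  [set z | H2 z /\ forall g, Gamma_R g -> Im (mobius g z) <= Im z].

Definition F_R (G : set R) : set C := [set z | F1_R z /\ G (Re z)].

End upper_half_plane.

Definition frontier (X : topologicalType) (A : set X) : set X :=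
  closure A `\` interior A.

(* Fundamental domain for the action of Delta / {I, -I} on X. *)
Definition fundamental_domain (K : nzRingType) (X : topologicalType)
    (Delta : set 'M[K]_2) (act : 'M[K]_2 -> X -> X) (F : set X) : Prop :=
  [set: X] = \bigcup_(g in Delta) (act g @` F) /\
  forall g1 g2, Delta g1 -> Delta g2 -> g1 <> g2 -> g1 <> - g2 ->
    act g1 @` F `&` act g2 @` F `<=`
      act g1 @` frontier F `&` act g2 @` frontier F.

Section geodesics.
Variable R : realType.
Local Notation C := R[i].

Definition arcosh (u : R) : R := ln (u + Num.sqrt (u ^+ 2 - 1)).

Definition hdist (z w : C) : R :=
  arcosh (1 + ((Re z - Re w) ^+ 2 + (Im z - Im w) ^+ 2) / (2 * Im z * Im w)).

(* The closure of H2 in the Riemann sphere; None is the point at infinity. *)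
Definition H2bar : set (option C) :=
  [set p | if p is Some z then 0 <= Im z else True].

(* Complete geodesics parametrized by arc length. *)
Definition geodesic_line (c : R -> C) : Prop :=
  (forall t, H2 (c t)) /\ forall s t, hdist (c s) (c t) = `|s - t|.

Definition cvg_sphere (c : R -> C) (F : set_system R) (p : option C) : Prop :=
  if p is Some a then
    (Re (c t) @[t --> F] --> Re a) /\ (Im (c t) @[t --> F] --> Im a)
  else Re (c t) ^+ 2 + Im (c t) ^+ 2 @[t --> F] --> +oo.

(* The value at time t in [-oo, +oo] of c extended to its ideal endpoints. *)
Definition geodesic_at (c : R -> C) (t : \bar R) (p : option C) : Prop :=
  match t with
  | EFin r => p = Some (c r)
  | +oo%E => cvg_sphere c (pinfty_nbhs R) p
  | -oo%E => cvg_sphere c (ninfty_nbhs R) p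
  end.

Definition geodesically_convex (S : set (option C)) : Prop :=
  S `<=` H2bar /\
  forall (c : R -> C) (s t : \bar R) (p q : option C),
    geodesic_line c -> geodesic_at c s p -> geodesic_at c t q -> S p -> S q ->
    forall u : R, (s <= u%:E <= t)%E -> S (Some (c u)).

Definition convex_hull (P : set (option C)) : set (option C) :=
  smallest geodesically_convex P.

End geodesics.

Section lemmas.
Variable R : realType.
Local Notation C := R[i].

Lemma mx2_eta (K : nzRingType) (M : 'M[K]_2) :
  M = mx2 (M 0 0) (M 0 1) (M 1 0) (M 1 1).
Proof.
by apply/matrixP => i j; rewrite mxE; case: i j => [[|[]]// hi] [[|[]]// hj] /=;
  congr (M _ _); apply/val_inj.
Qed.

Lemma sl2_basis_comb (f : 'I_3 -> C) :
  \sum_i f i *: tnth (sl2_basis R) i =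
  mx2 (f 2%:R) (f 0 + 'i%C * f 1) (f 0 - 'i%C * f 1) (- f 2%:R).
Proof.
have -> : 2%:R = lift 0 (lift 0 0) :> 'I_3 by apply/val_inj.
have -> : 1 = lift 0 0 :> 'I_3 by apply/val_inj.
rewrite !big_ord_recl big_ord0 addr0 !(tnth_nth 0) /=.
apply/matrixP => i j; rewrite !mxE; case: i j => [[|[]]// hi] [[|[]]// hj] /=;
  by rewrite ?mulr0 ?mulr1 ?add0r ?addr0 ?mulrN ?mulr1 // [f _ * 'i%C]mulrC.
Qed.

Lemma sl2_basis_free : free (sl2_basis R).
Proof.
apply/freeP => k.
under eq_bigr do rewrite -tnth_nth.
rewrite sl2_basis_comb => /matrixP E i.
have := E 0 0; have := E 0 1; have := E 1 0; rewrite !mxE /= => e1 e2 e3.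
have k0 : k 0 = 0.
  have : k 0 + k 0 = 0 by rewrite -[RHS]addr0 -{1}e1 -e2 addrACA addNr addr0.
  by move/eqP; rewrite -mulr2n mulrn_eq0 /= => /eqP.
have k1 : k 1 = 0.
  move: e2; rewrite k0 add0r => /eqP; rewrite mulf_eq0 => /orP[|/eqP//].
  by rewrite eq_complex /= oner_eq0 andbF.
by case: i => [[|[|[]]]// hi]; [rewrite -k0|rewrite -k1|rewrite -e3];
  congr k; apply/val_inj.
Qed.

(* conj_mx g is the matrix of X |-> g X g^-1 on sl_2. *)
Lemma conj_mxE (g : 'M[C]_2) j : SL2 g ->
  g *m tnth (sl2_basis R) j *m invmx g =
  \sum_i conj_mx g i j *: tnth (sl2_basis R) i.
Proof.
move=> dg; set M := LHS.
have trM : \tr M = 0.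
  rewrite /M mxtrace_mulC mulmxA mulVmx ?mul1mx; last first.
    by rewrite unitmxE dg unitr1.
  by case: j {M} => [[|[|[]]]// hj]; rewrite (tnth_nth 0) /mxtrace /=
    !big_ord_recl big_ord0 !mxE /= ?addr0 // addrN.
have MS : M \in <<sl2_basis R>>%VS.
  pose f (i : 'I_3) : C := nth 0
    [:: (M 0 1 + M 1 0) / 2; (M 0 1 - M 1 0) / (2 * 'i%C); M 0 0] i.
  have -> : M = \sum_i f i *: tnth (sl2_basis R) i.
    have e4 : M 1 1 = - M 0 0.
      move: trM; rewrite /mxtrace !big_ord_recl big_ord0 addr0.
      have -> : lift ord0 ord0 = 1 :> 'I_2 by apply/val_inj.
      by move/eqP; rewrite addrC addr_eq0 => /eqP.
    have i0 : 'i%C != 0 :> C by rewrite eq_complex /= oner_eq0 andbF.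
    have e5 : 'i%C * ((M 0 1 - M 1 0) / (2 * 'i%C)) = (M 0 1 - M 1 0) / 2.
      by field; rewrite i0 /=.
    rewrite sl2_basis_comb [LHS]mx2_eta /f /= e4 e5.
    by congr mx2; field.
  by apply: rpred_sum => i _; apply: rpredZ; apply: memv_span; exact: mem_tnth.
rewrite [LHS](coord_span MS); apply: eq_bigr => i _.
by rewrite mxE -tnth_nth.
Qed.

Lemma det_mx2 (K : comNzRingType) (g : 'M[K]_2) :
  \det g = g 0 0 * g 1 1 - g 0 1 * g 1 0.
Proof.
have l1 : lift 0 0 = 1 :> 'I_2 by apply/val_inj.
have l2 : lift 1 0 = 0 :> 'I_2 by apply/val_inj.
rewrite (expand_det_row _ 0) !big_ord_recl big_ord0 /cofactor !det_mx11 !mxE.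
by rewrite /= !l1 !l2 /= /bump /= expr0 expr1 mul1r mulN1r mulrN addr0.
Qed.

Lemma induced_actE (g : 'M[R]_2) (z : C) :
  height_stabilizer g -> H2 z -> induced_act g (Re z) = Re (mobius g z).
Proof.
move=> [[dg _] hg]; case: z => x y hz.
have := hg (0 +i* 1) ltr01; have := hg (0 +i* 2) (ltr0Sn _ 1).
move: dg; rewrite /SL2 /= det_mx2 /induced_act /mobius /=.
move: (g 0 0) (g 0 1) (g 1 0) (g 1 1) => a b c d dg.
rewrite !(mul0r, mulr0, addr0, oppr0, add0r, subr0, mulr1).
have key t n : t != 0 -> b * - (c * t / n) + a * t * (d / n) = t -> n = 1.
  move=> t0 e; have : t / n = t.
    by rewrite -[RHS]e -[t in LHS]mulr1 -dg; ring.
  have [->|n0] := eqVneq n 0; first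
    by rewrite invr0 mulr0 => /esym/eqP; rewrite (negPf t0).
  move=> /(congr1 (fun u => u * n)); rewrite divfK // -{1}[t]mulr1.
  by move/(mulfI t0).
move=> /(key _ _ (lt0r_neq0 (ltr0Sn _ 1))) e2.
have := key 1 (d ^+ 2 + c ^+ 2); rewrite !mulr1.
move=> /(_ (oner_neq0 _)) /[apply] e1.
have c0 : c = 0 by apply/eqP; rewrite -sqrf_eq0; apply/eqP; lra.
by rewrite c0 !(mul0r, mulr0, oppr0, subr0, expr0n, add0r, addr0).
Qed.

End lemmas.

(* Main.v *)
(* Conjugation by a real g = [[a, b], [c, d]] has real or purely imaginary
   quadratic forms in a, b, c, d as entries, so Gamma_R is cut out by
   integrality conditions. They force 2 c^2 to be an integer: either c = 0, or
   c^2 = 1/2 and d = m c with m odd, or c^2 >= 1. Since Im (g z) = y / |c z + d|^2,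
   the height is maximal on its orbit as soon as |z - 1|^2 >= 2 for x in [0, 2],
   and the bound |z - 1|^2 >= 2 is the one given by the element of order 4
   in PSL_2 with bottom row (1, -1) / sqrt 2.
   For the convex hull, in the hyperboloid model a unit speed geodesic has the
   form e^t P + e^-t Q, on which linear forms (the sides of the domain)
   that are nonnegative at two times are nonnegative in between. Conversely the
   hull contains the arc from i to 2 + i, and the vertical rays above it. *)
Require Import Defs.
From mathcomp Require Import all_boot all_order all_algebra.
From mathcomp Require Import all_classical all_reals all_analysis.
From mathcomp Require Import complex ring lra zify.
Set Implicit Arguments.
Unset Strict Implicit.
Unset Printing Implicit Defensive.
Import Order.TTheory GRing.Theory Num.Theory.
Import numFieldNormedType.Exports.
Local Open Scope classical_set_scope.
Local Open Scope ring_scope.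
Local Open Scope complex_scope.
Local Notation Re := complex.Re.
Local Notation Im := complex.Im.

(** * The adjoint representation of real matrices and the integrality conditions for [Gamma_R] *)

Section matrices.

Lemma mulmx_mx2 (K : nzRingType) (a b c d a' b' c' d' : K) :
  mx2 a b c d *m mx2 a' b' c' d' =
  mx2 (a * a' + b * c') (a * b' + b * d') (c * a' + d * c') (c * b' + d * d').
Proof.
apply/matrixP => i j; rewrite !mxE !big_ord_recl big_ord0 !mxE.
by case: i j => [[|[]]// hi] [[|[]]// hj] /=; rewrite addr0.
Qed.

Lemma invmx_mx2 (K : comUnitRingType) (a b c d : K) :
  a * d - b * c = 1 -> invmx (mx2 a b c d) = mx2 d (- b) (- c) a.
Proof.
move=> h; have e : mx2 a b c d *m mx2 d (- b) (- c) a = 1%:M.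
  rewrite mulmx_mx2; apply/matrixP => i j; rewrite !mxE.
  case: i j => [[|[]]// hi] [[|[]]// hj] /=; rewrite -?h; ring.
by have [u _] := mulmx1_unit e; rewrite -[LHS]mulmx1 -e mulKmx.
Qed.

Lemma ord3_cases (i : 'I_3) : i = 0 \/ i = 1 \/ i = 2%:R.
Proof.
by case: i => [[|[|[]]]// hi]; [left|right; left|right; right]; apply/val_inj.
Qed.

Variable R : realType.
Local Notation C := R[i].

(** A combination of the basis has off-diagonal entries [u0 + i u1] and [u0 - i u1]; their half-sum,
    and their half-difference divided by [i], recover the coordinates. Real and imaginary parts are
    kept apart so that real [g] leads to real identities. *)
Lemma conj_mx_coef (g : 'M[C]_2) (j : 'I_3) (p q r s : C) : SL2 g ->
  g *m tnth (sl2_basis R) j *m invmx g = mx2 p q r s ->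
  [/\ conj_mx g 0 j = (Re (q + r) / 2) +i* (Im (q + r) / 2),
      conj_mx g 1 j = (Im (q - r) / 2) +i* (- Re (q - r) / 2) &
      conj_mx g 2%:R j = p].
Proof.
move=> hg; rewrite (conj_mxE _ hg); pose f i := conj_mx g i j.
rewrite -[conj_mx g 0 j]/(f 0) -[conj_mx g 1 j]/(f 1).
rewrite -[conj_mx g _ j]/(f 2%:R) (sl2_basis_comb f); clearbody f.
move=> /matrixP e; have := e 0 0; have := e 0 1; have := e 1 0.
rewrite !mxE /= => <- <- <-; case: (f 0) (f 1) => [u0 v0] [u1 v1].
by split=> //=; apply/eqP; rewrite eq_complex /=; apply/andP;
  split; apply/eqP; field.
Qed.

(** The image under the adjoint representation of the real matrix with rows [(a, b)] and [(c, d)].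
    The second basis vector is [i] times a real matrix, so exactly the entries with one index equal
    to 1 are purely imaginary. *)
Definition adjoint_mx (a b c d : R) : 'M[C]_3 :=
  \matrix_(i, j) nth 0 (nth [::]
   [:: [:: (a ^+ 2 - b ^+ 2 - c ^+ 2 + d ^+ 2) / 2 +i* 0;
           0 +i* ((a ^+ 2 + b ^+ 2 - c ^+ 2 - d ^+ 2) / 2);
           (c * d - a * b) +i* 0];
       [:: 0 +i* ((d ^+ 2 + b ^+ 2 - c ^+ 2 - a ^+ 2) / 2);
           (a ^+ 2 + b ^+ 2 + c ^+ 2 + d ^+ 2) / 2 +i* 0;
           0 +i* (a * b + c * d)];
       [:: (b * d - a * c) +i* 0;
           0 +i* (- (a * c + b * d));
           (a * d + b * c) +i* 0]] i) j.

Lemma conj_mx_real (a b c d : R) : a * d - b * c = 1 ->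
  conj_mx (map_mx (real_complex R) (mx2 a b c d)) = adjoint_mx a b c d.
Proof.
move=> h.
have eg : map_mx (real_complex R) (mx2 a b c d) = mx2 a%:C b%:C c%:C d%:C.
  by apply/matrixP => i j; rewrite !mxE;
    case: i j => [[|[]]// hi] [[|[]]// hj].
have hC : a%:C * d%:C - b%:C * c%:C = 1.
  by rewrite -!rmorphM -rmorphB /= h.
have hg : SL2 (mx2 a%:C b%:C c%:C d%:C).
  by rewrite /SL2 /= det_mx2 !mxE /=.
rewrite eg; apply/matrixP => i j;
  have H p q r s := @conj_mx_coef _ j p q r s hg; move: H.
rewrite (invmx_mx2 hC) (tnth_nth 0).
have [->|[->|->]] := ord3_cases j; rewrite /= !mulmx_mx2 => /(_ _ _ _ _ erefl) [].
all: have [->|[->|->]] := ord3_cases i => e0 e1 e2.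
all: by rewrite ?e0 ?e1 ?e2 {e0 e1 e2} mxE /=; apply/eqP; rewrite eq_complex /=;
  apply/andP; split; apply/eqP; field.
Qed.

Lemma adjoint_mx_SO3 (a b c d : R) : a * d - b * c = 1 ->
  SO3 (adjoint_mx a b c d).
Proof.
move=> h; split; last first.
  rewrite /= (expand_det_row _ 0) !big_ord_recl big_ord0 /cofactor !det_mx2 !mxE.
  rewrite /= /bump /= ?(expr0, expr1) /= expr2.
  apply/eqP; rewrite eq_complex; apply/andP; split; apply/eqP => /=; last by field.
  rewrite ?(mul0r, mulr0, addr0, subr0, sub0r, oppr0, add0r).
  by transitivity ((a * d - b * c) ^+ 3); [field|rewrite h expr1n].
apply/matrixP => i j; rewrite !mxE !big_ord_recl big_ord0 !mxE addr0.
have [->|[->|->]] := ord3_cases i; have [->|[->|->]] := ord3_cases j.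
all: rewrite /=; apply/eqP; rewrite eq_complex; apply/andP; split; apply/eqP => /=.
all: rewrite ?(mul0r, mulr0, addr0, subr0, sub0r, oppr0, add0r) //.
(* The off-diagonal products vanish identically; each diagonal one is [(a * d - b * c) ^+ 2]. *)
all: try (by field).
all: by transitivity ((a * d - b * c) ^+ 2); [field|rewrite h expr1n].
Qed.

Lemma gaussian_real (x : R) : gaussian_integers (x +i* 0) <-> x \is a Num.int.
Proof.
split=> [[m [n [-> _]]]|/intrP[m ->]]; first exact: intr_int.
by exists m, 0.
Qed.

Lemma gaussian_imag (x : R) : gaussian_integers (0 +i* x) <-> x \is a Num.int.
Proof.
split=> [[m [n [_ ->]]]|/intrP[m ->]]; first exact: intr_int.
by exists 0, m.
Qed.

(** Orthogonality and determinant 1 follow from [adjoint_mx_SO3], so beyond [a * d - b * c = 1] only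
    the integrality of the nine entries remains. *)
Lemma Gamma_RP (a b c d : R) :
  Gamma_R (mx2 a b c d) <-> a * d - b * c = 1 /\
    [/\ [/\ (a ^+ 2 - b ^+ 2 - c ^+ 2 + d ^+ 2) / 2 \is a Num.int,
            (a ^+ 2 + b ^+ 2 - c ^+ 2 - d ^+ 2) / 2 \is a Num.int,
            (d ^+ 2 + b ^+ 2 - c ^+ 2 - a ^+ 2) / 2 \is a Num.int &
            (a ^+ 2 + b ^+ 2 + c ^+ 2 + d ^+ 2) / 2 \is a Num.int],
        [/\ c * d - a * b \is a Num.int & a * b + c * d \is a Num.int],
        [/\ b * d - a * c \is a Num.int & a * c + b * d \is a Num.int] &
        a * d + b * c \is a Num.int].
Proof.
have detE : \det (mx2 a b c d) = a * d - b * c by rewrite det_mx2 !mxE.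
split=> [[+ [_ []]]|[h]].
  rewrite /SL2 /= detE => h _; rewrite conj_mx_real // => H; split=> //.
  have := (H 0 0, H 0 1, H 0 2%:R, H 1 0, H 1 1, H 1 2%:R,
           (H 2%:R 0, H 2%:R 1, H 2%:R 2%:R)).
  rewrite !mxE /= => -[[[[[[/gaussian_real ? /gaussian_imag ?] /gaussian_real ?]
    /gaussian_imag ?] /gaussian_real ?] /gaussian_imag ?]
    [[/gaussian_real ? /gaussian_imag ?] /gaussian_real ?]].
  by do !split => //; rewrite -rpredN.
move=> [[h1 h2 h3 h4] [h5 h6] [h7 h8] h9]; split; first by rewrite /SL2 /= detE.
split; first by rewrite /SL2 /= det_map_mx detE h.
rewrite /preimage /= conj_mx_real //; split; first exact: adjoint_mx_SO3.
move=> i j; rewrite mxE.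
have [->|[->|->]] := ord3_cases i; have [->|[->|->]] := ord3_cases j;
  first [apply/gaussian_real | apply/gaussian_imag] => /=.
all: by rewrite ?rpredN.
Qed.

End matrices.

(** * Heights under [Gamma_R]: the stabilizer and the domain of maximal height *)

Section height.
Variable R : realType.
Local Notation C := R[i].

Lemma mobius_den_gt0 (a b c d x y : R) : a * d - b * c = 1 -> 0 < y ->
  0 < (c * x + d) ^+ 2 + (c * y) ^+ 2.
Proof.
move=> h y0; have [c0|c0] := eqVneq c 0.
  have d0 : d != 0 by apply: contra_eq_neq h => ->; rewrite c0; lra.
  by rewrite c0 !mul0r add0r expr0n addr0 exprn_even_gt0.
by rewrite ltr_wpDl ?sqr_ge0 // exprn_even_gt0 //= mulf_neq0 // gt_eqF.
Qed.

Lemma Im_mobius (a b c d x y : R) : a * d - b * c = 1 -> 0 < y ->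
  Im (mobius (mx2 a b c d) (x +i* y)) = y / ((c * x + d) ^+ 2 + (c * y) ^+ 2).
Proof.
move=> h y0; have := mobius_den_gt0 x h y0; set N := _ + _ => /lt0r_neq0 N0.
rewrite /mobius !mxE /= !(mul0r, mulr0, addr0, oppr0, add0r, subr0) -/N.
by rewrite -[y in RHS]mulr1 -h; field.
Qed.

Lemma sqr_half_int_even (n : int) :
  n%:~R ^+ 2 / 2 \is a @Num.int R -> exists m : int, n = 2 * m.
Proof.
move=> /intrP[m e]; suff : (2 %| n)%Z by move=> /dvdzP[q ->]; exists q;
  rewrite mulrC.
have {}e : n * n = m * 2.
  by apply/eqP; rewrite -(eqr_int R) !rmorphM /= -e; apply/eqP; field.
have : (2 %| n * n)%Z by rewrite e dvdz_mull.
by rewrite !dvdzE abszM Euclid_dvdM // orbb.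
Qed.

(** Preserving heights means |cz + d| = 1 for all z; comparing z = i with z = 2i gives [c = 0], then
    [d] is 1 or -1 and [a = d]. Integrality makes the translation length even. *)
Lemma height_stabilizerE :
  @height_stabilizer R = [set g | exists n : int, g = mx2 1 (2 * n%:~R) 0 1 \/
                                 g = - mx2 1 (2 * n%:~R) 0 1].
Proof.
have Nmx2 (x : R) : - mx2 1 x 0 1 = mx2 (-1) (- x) 0 (-1).
  apply/matrixP => i j; rewrite !mxE.
  by case: i j => [[|[]]// hi] [[|[]]// hj] /=; rewrite ?oppr0.
apply/seteqP; split=> g /=.
  rewrite [g]mx2_eta; move: (g 0 0) (g 0 1) (g 1 0) (g 1 1) => a b c d {g}.
  move=> [/Gamma_RP[h [[h1 _ _ _] _ [h7 h8] _]] H].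
  have N1 y : 0 < y -> d ^+ 2 + (c * y) ^+ 2 = 1.
    move=> y0; have := H (0 +i* y) y0; rewrite (Im_mobius _ h y0) mulr0 add0r /=.
    have := mobius_den_gt0 0 h y0;
      rewrite mulr0 add0r => N0 /(congr1 (fun u => u / y)).
    by rewrite mulrAC divff ?gt_eqF // mul1r => /(congr1 GRing.inv);
      rewrite invrK invr1.
  have c0 : c = 0.
    have := N1 1 ltr01; have := N1 2 (ltr0Sn _ 1) => e1 e2.
    by apply/eqP; rewrite -sqrf_eq0; apply/eqP; lra.
  have d2 : d ^+ 2 = 1 by have := N1 1 ltr01; rewrite c0; lra.
  have aE : a = d.
    by rewrite -[LHS]mulr1 -d2 expr2 mulrA; move: h;
      rewrite c0 mulr0 subr0 => ->; rewrite mul1r.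
  rewrite {}aE {}c0 in h h1 h7 h8 *.
  have bd : b * d \is a Num.int by rewrite mulr0 subr0 in h7.
  have /intrP[n bE] := bd.
  (* Here [n ^+ 2 = b ^+ 2], and the first integrality condition now says that [1 - b ^+ 2 / 2] is
     an integer. *)
  have [m nE] : exists m : int, n = 2 * m.
    apply: sqr_half_int_even; rewrite -bE exprMn d2 mulr1.
    rewrite (_ : _ / 2 = 1 - (d ^+ 2 - b ^+ 2 - 0 ^+ 2 + d ^+ 2) / 2) ?rpredB
      ?rpred1 //.
    by rewrite d2; field.
  have bE' : b = n%:~R * d by rewrite -bE -mulrA -expr2 d2 mulr1.
  exists m; rewrite Nmx2 bE' nE rmorphM /=.
  move/eqP: d2; rewrite sqrf_eq1 => /orP[]/eqP->; [left|right];
    by rewrite ?mulrN ?mulr1.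
move=> [n gE]; have [e [e2 {}gE]] : exists e : R, e ^+ 2 = 1 /\ g = mx2 e (e *
  (2 * n%:~R)) 0 e.
  by case: gE => ->; [exists 1|exists (-1)];
    rewrite ?Nmx2 ?sqrrN ?expr1n ?mulN1r ?mul1r.
have h : e * e - e * (2 * n%:~R) * 0 = 1 by rewrite -expr2 e2; ring.
split; last first.
  move=> [x y] y0; rewrite gE Im_mobius //= !mul0r add0r expr0n addr0 e2 divr1 //.
have sqE : (e * (2 * n%:~R)) ^+ 2 = 4 * n%:~R ^+ 2 by rewrite exprMn e2; ring.
have eeE : e * (e * (2 * n%:~R)) = (2 * n)%:~R.
  by rewrite mulrA -expr2 e2 mul1r rmorphM.
have intE (u : R) (k : int) : u = k%:~R -> u \is a Num.int by move=> ->;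
  exact: intr_int.
rewrite gE; apply/Gamma_RP; split => //; rewrite sqE e2 !mul0r !mulr0.
rewrite (mulrC (e * _)) eeE !(add0r, addr0, subr0, sub0r) -expr2 e2; do !split.
- by apply: (intE _ (1 - 2 * n * n)); rewrite ?(rmorphB, rmorphD, rmorphM) /=;
  field.
- by apply: (intE _ (2 * n * n)); rewrite ?(rmorphB, rmorphD, rmorphM) /=; field.
- by apply: (intE _ (2 * n * n)); rewrite ?(rmorphB, rmorphD, rmorphM) /=; field.
- by apply: (intE _ (1 + 2 * n * n)); rewrite ?(rmorphB, rmorphD, rmorphM) /=;
  field.
all: by rewrite ?rpredN ?rpred1 // intr_int.
Qed.

(** The three cases are the values 0, 1 and at least 2 of the integer [2 * c ^+ 2]. Excluding 0 and
    -2 ensures |x + m| >= 1 on [[0, 2]] for every [m] other than -1. *)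
Lemma Gamma_bottom_row (a b c d : R) : Gamma_R (mx2 a b c d) ->
  [\/ c = 0 /\ 1 <= d ^+ 2,
      c ^+ 2 = 1 / 2 /\
        exists m : int, [/\ d = m%:~R * c, m != 0 & m != -2] |
      1 <= c ^+ 2].
Proof.
move=> /Gamma_RP[h [[h1 h2 h3 h4] [h5 h6] _ _]].
have /intrP[k kE] : 2 * c ^+ 2 \is a Num.int.
  have -> : 2 * c ^+ 2 = (a ^+ 2 + b ^+ 2 + c ^+ 2 + d ^+ 2) / 2
    - (a ^+ 2 - b ^+ 2 - c ^+ 2 + d ^+ 2) / 2
    - (a ^+ 2 + b ^+ 2 - c ^+ 2 - d ^+ 2) / 2
    - (d ^+ 2 + b ^+ 2 - c ^+ 2 - a ^+ 2) / 2 by field.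
  by rewrite !rpredB.
have /intrP[l lE] : d ^+ 2 - c ^+ 2 \is a Num.int.
  have -> : d ^+ 2 - c ^+ 2 = (a ^+ 2 - b ^+ 2 - c ^+ 2 + d ^+ 2) / 2
    + (d ^+ 2 + b ^+ 2 - c ^+ 2 - a ^+ 2) / 2 by field.
  by rewrite rpredD.
have /intrP[m mE] : 2 * (c * d) \is a Num.int.
  by have -> : 2 * (c * d) = (c * d - a * b) + (a * b + c * d);
    [ring|rewrite rpredD].
have c2 : 0 <= c ^+ 2 := sqr_ge0 c.
have k0 : 0 <= k by rewrite -(ler0z R) -kE mulr_ge0.
have [k0'|[k1|k2]] : k = 0 \/ k = 1 \/ 2 <= k by lia.
- rewrite k0' in kE; constructor 1; have c0 : c = 0.
    by apply/eqP; rewrite -sqrf_eq0; apply/eqP; lra.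
  split=> //; rewrite c0 expr0n subr0 in lE.
  have d0 : d != 0 by apply: contra_eq_neq h => ->; rewrite c0; lra.
  have : 0 < d ^+ 2 by rewrite exprn_even_gt0.
  by rewrite lE ltr0z ler1z gtz0_ge1.
- constructor 2; have c12 : c ^+ 2 = 1 / 2 by move: kE; rewrite k1; lra.
  have dE : d = m%:~R * c by rewrite -mE; transitivity (2 * c ^+ 2 * d);
    [rewrite c12; field|ring].
  (* The integer [l = d ^+ 2 - c ^+ 2] equals [(m ^+ 2 - 1) / 2], so [m] is odd. *)
  split=> //; exists m; suff : m * m = 2 * l + 1 by split=> //; lia.
  apply/eqP; rewrite -(eqr_int R) rmorphM rmorphD rmorphM /= -lE dE exprMn c12.
  by apply/eqP; field.
- by constructor 3; rewrite -(ler_int R) in k2; lra.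
Qed.

(** A rotation about the corner i, with square z -> -1/z; its isometric circle |z - 1|^2 = 2 carries
    the lower side of the domain. *)
Lemma Gamma_order4 (s : R) : s ^+ 2 = 1 / 2 -> Gamma_R (mx2 (- s) (- s) s (- s)).
Proof.
move=> s2; have ss : s * s = 1 / 2 by rewrite -expr2.
have intE (u : R) (k : int) : u = k%:~R -> u \is a Num.int by move=> ->;
  exact: intr_int.
apply/Gamma_RP; rewrite !(mulrN, mulNr, opprK) ?ss !sqrrN s2; split; first by lra.
by do !split; apply/intrP;
  solve [exists 0; rewrite /=; lra | exists 1; rewrite /=; lra
        | exists (-1); rewrite ?rmorphN /=; lra].
Qed.

Lemma F_RE : F_R [set` `[0, 2 : R]] =
  [set z | [/\ H2 z, 0 <= Re z <= 2 & 2 <= Im z ^+ 2 + (Re z - 1) ^+ 2]].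
Proof.
apply/seteqP; split=> -[x y] /=.
  move=> [[y0 H] xI]; split=> //; rewrite /H2 /= in y0.
  pose s : R := Num.sqrt (1 / 2).
  have s2 : s ^+ 2 = 1 / 2 by rewrite sqr_sqrtr // divr_ge0.
  have Gs := Gamma_order4 s2; have /Gamma_RP[h _] := Gs.
  have := H _ Gs; rewrite Im_mobius //=; have := mobius_den_gt0 x h y0.
  set N := _ + _ => N0; rewrite ler_pdivrMr // ler_pMr //.
  by rewrite /N (_ : _ + _ = s ^+ 2 * (y ^+ 2 + (x - 1) ^+ 2)); [rewrite s2;
    lra|ring].
move=> [y0 /andP[x0 x2] hz]; split; last by rewrite /= in_itv /= x0 x2.
split; first exact: y0.
move=> g; rewrite [g]mx2_eta; move: (g 0 0) (g 0 1) (g 1 0) (g 1 1) => a b c d Gg.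
rewrite /H2 /= in y0.
have /Gamma_RP[h _] := Gg; rewrite Im_mobius //=; have := mobius_den_gt0 x h y0.
move=> N0; rewrite ler_pdivrMr // ler_pMr //.
(* On [[0, 2]] the term [(x - 1) ^+ 2] is at most 1. *)
have y1 : 1 <= y ^+ 2 by nra.
have [[-> d1]|[c2 [m [-> m0 m2]]]|c1] := Gamma_bottom_row Gg.
- by rewrite !mul0r add0r expr0n addr0.
- rewrite (_ : _ + _ = c ^+ 2 * ((x + m%:~R) ^+ 2 + y ^+ 2)); last by ring.
  (* In the outer cases both squares are at least 1; for [m = -1] the claim is the hypothesis
     [hz]. *)
  rewrite c2; have [m1|[m1|m3]] : m <= -3 \/ m = -1 \/ 1 <= m by lia.
  + by move: m1; rewrite -(ler_int R) => m1; nra.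
  + by rewrite m1; lra.
  + by move: m3; rewrite -(ler_int R) => m3; nra.
- rewrite (le_trans c1) // exprMn; have := sqr_ge0 (c * x + d); nra.
Qed.

(** * The induced translations of the real line and the interval [[0, 2]] *)

Lemma height_stabilizer_translation (g : 'M[R]_2) : height_stabilizer g ->
  exists2 n : int, g = mx2 1 (2 * n%:~R) 0 1 \/ g = - mx2 1 (2 * n%:~R) 0 1 &
    forall x, induced_act g x = x + 2 * n%:~R.
Proof.
rewrite height_stabilizerE => -[n gE]; exists n => // x.
by rewrite /induced_act /mobius; case: gE => ->; rewrite !mxE /=; field.
Qed.

(** The interval is the closed ball of radius 1 about 1, defined as the closure of the open ball. *)
Lemma closure_interior_itv02 :
  [set` `[0, 2 : R]] = @closure R (@interior R [set` `[0, 2]]).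
Proof.
have := closed_ball_itv (1 : R) (ltr01 : 0 < (1 : R)).
by rewrite interior_itv_bnd /closed_ball ball_itv subrr => /esym.
Qed.

Lemma frontier_itv02 (x : R) : x = 0 \/ x = 2 -> @frontier R [set` `[0, 2]] x.
Proof.
move=> xE; split; last by rewrite interior_itv /= in_itv /=; case: xE => ->;
  rewrite ltxx ?andbF.
by apply: subset_closure; rewrite /= in_itv /=; case: xE => ->; rewrite lexx ler0n.
Qed.

Lemma fundamental_domain_itv02 :
  @fundamental_domain R R (@height_stabilizer R) (@induced_act R) [set` `[0, 2]].
Proof.
split.
  apply/seteqP; split=> // x _; pose n := Num.floor (x / 2).
  have Gn : height_stabilizer (mx2 1 (2 * n%:~R) 0 1 : 'M[R]_2).
    by rewrite height_stabilizerE; exists n; left.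
  exists (mx2 1 (2 * n%:~R) 0 1) => //; exists (x - 2 * n%:~R).
    have /andP[] := floor_itv (x / 2); rewrite -/n intrD => n1 n2.
    by rewrite /= in_itv /=; apply/andP; split; lra.
  by rewrite /induced_act /mobius !mxE /=; field.
move=> g1 g2 /height_stabilizer_translation[n1 E1 H1].
move=> /height_stabilizer_translation[n2 E2 H2] ne neN t /=.
move=> [[u + ut] [v + vt]]; rewrite /= !in_itv /= => uI vI; rewrite H1 in ut;
  rewrite H2 in vt.
have nn : n1 <> n2.
  move=> nE; rewrite nE in E1.
  by case: E1 E2 => E1 [] E2; rewrite E1 E2 ?opprK in ne neN.
clear E1 E2 ne neN.
(* Points of [[0, 2]] differ by at most 2, so [n2 - n1] is 1 or -1 and [u], [v] are opposite
   ends. *)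
have uv : u - v = 2 * (n2 - n1)%:~R by rewrite rmorphB /=; lra.
move: uI vI => /andP[u0 u2] /andP[v0 v2].
have [n12|[n12|n12]] : 2 <= n2 - n1 \/ n2 - n1 <= -2 \/ n2 - n1 = 1 \/ n2 - n1
  = -1 by lia.
- by exfalso; rewrite -(ler_int R) in n12; lra.
- by exfalso; rewrite -(ler_int R) in n12; lra.
- have [fu fv] : (u = 0 \/ u = 2) /\ (v = 0 \/ v = 2).
    by case: n12 uv => ->; rewrite ?rmorphN /= => uv; split;
      [right|left|left|right]; lra.
  by split; [exists u; rewrite ?H1 //; exact: frontier_itv02|
             exists v; rewrite ?H2 //; exact: frontier_itv02].
Qed.

End height.

(** * Unit speed geodesics in hyperboloid coordinates and their ideal endpoints *)

Section geodesics_of_the_half_plane.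
Variable R : realType.
Local Notation C := R[i].

(** The argument is cosh (ln q), and the root in [arcosh] is |q - 1/q| / 2, so the logarithm is
    taken of the larger of q and 1/q. *)
Lemma arcosh_exp (q : R) : 0 < q -> arcosh ((q + q^-1) / 2) = `|ln q|.
Proof.
move=> q0; rewrite /arcosh.
have -> : ((q + q^-1) / 2) ^+ 2 - 1 = ((q - q^-1) / 2) ^+ 2 by field;
  rewrite gt_eqF.
have qV0 : 0 < q^-1 by rewrite invr_gt0.
rewrite sqrtr_sqr; have [q1|q1] := leP 1 q.
  have : q^-1 <= 1 by rewrite invf_le1.
  move=> qV1; rewrite [`|_ / 2|]ger0_norm ?ger0_norm ?ln_ge0 //; last by lra.
  by congr ln; field; rewrite gt_eqF.
have : 1 <= q^-1 by rewrite invf_ge1 // ltW.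
move=> qV1; rewrite [`|_ / 2|]ler0_norm; last by lra.
rewrite ler0_norm ?ln_le0 ?(ltW q1) // -lnV ?posrE //.
by congr ln; field; rewrite gt_eqF.
Qed.

Lemma arcosh_eq_norm (u r : R) : 1 <= u -> arcosh u = `|r| ->
  u = (expR r + expR (- r)) / 2.
Proof.
move=> u1; have v0 : 0 <= u ^+ 2 - 1 by nra.
rewrite /arcosh; set v := Num.sqrt _.
have v2 : v ^+ 2 = u ^+ 2 - 1 by rewrite sqr_sqrtr.
have vge : 0 <= v := sqrtr_ge0 _.
have w0 : 0 < u + v by lra.
move=> /(congr1 expR); rewrite lnK ?posrE // => e.
have eV : expR (- `|r|) = u - v.
  by rewrite expRN -e; apply: (mulfI (lt0r_neq0 w0)); rewrite divff ?gt_eqF //; lra.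
have -> : expR r + expR (- r) = expR `|r| + expR (- `|r|).
  by have [_|_] := ger0P r; rewrite ?opprK // addrC.
by rewrite -e eV; field.
Qed.

(** The distance formula without [arcosh] or denominators: the left side is |c s - c t|^2 + 2 Im (c
    s) Im (c t), the right side 2 Im (c s) Im (c t) cosh (s - t). *)
Lemma geodesic_line_eq (c : R -> C) : geodesic_line c -> forall s t,
  Re (c s) ^+ 2 + Im (c s) ^+ 2 + (Re (c t) ^+ 2 + Im (c t) ^+ 2)
    - 2 * Re (c s) * Re (c t) =
  Im (c s) * Im (c t) * (expR (s - t) + expR (t - s)).
Proof.
move=> [cH cd] s t; have ys : 0 < Im (c s) := cH s; have yt : 0 < Im (c t) := cH t.
have := cd s t => /arcosh_eq_norm; rewrite opprB.
have yy : 0 < 2 * Im (c s) * Im (c t) by rewrite !mulr_gt0.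
rewrite lerDl divr_ge0 ?addr_ge0 ?sqr_ge0 ?(ltW yy) // => /(_ isT) e.
have -> : expR (s - t) + expR (t - s) = 2 * ((expR (s - t) + expR (t - s)) / 2)
  by field.
by rewrite -e; field; rewrite !gt_eqF.
Qed.

Lemma geodesic_line_criterion (c : R -> C) : (forall t, 0 < Im (c t)) ->
  (forall s t, Re (c s) ^+ 2 + Im (c s) ^+ 2 + (Re (c t) ^+ 2 + Im (c t) ^+ 2)
    - 2 * Re (c s) * Re (c t) =
    Im (c s) * Im (c t) * (expR (s - t) + expR (t - s))) ->
  geodesic_line c.
Proof.
move=> y0 h; split=> // s t; rewrite /hdist.
have ys := y0 s; have yt := y0 t.
have -> : 1 + ((Re (c s) - Re (c t)) ^+ 2 + (Im (c s) - Im (c t)) ^+ 2)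
    / (2 * Im (c s) * Im (c t)) =
  (Re (c s) ^+ 2 + Im (c s) ^+ 2 + (Re (c t) ^+ 2 + Im (c t) ^+ 2)
    - 2 * Re (c s) * Re (c t)) / (2 * Im (c s) * Im (c t)).
  by field; rewrite !gt_eqF.
rewrite h -(opprB s t) expRN -[in RHS](expRK (s - t)) -arcosh_exp ?expR_gt0 //.
by congr arcosh; field; rewrite !gt_eqF // expR_gt0.
Qed.

(* The form p0 p2 - p1^2 has signature (1,2), so a null vector orthogonal to a
   timelike one vanishes. *)
Lemma null_orthogonal_timelike (w0 w1 w2 p0 p1 p2 : R) :
  p0 != 0 -> p0 * p2 - p1 ^+ 2 = 1 -> w0 * w2 = w1 ^+ 2 ->
  w0 * p2 + w2 * p0 - 2 * w1 * p1 = 0 -> [/\ w0 = 0, w1 = 0 & w2 = 0].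
Proof.
move=> p00 pp ww wp.
(* Multiplying the orthogonality relation by [w0 * p0] turns it into a sum of two squares. *)
have e : w0 ^+ 2 + (w0 * p1 - w1 * p0) ^+ 2 = 0.
  have : w0 * (w0 * p2 + w2 * p0 - 2 * w1 * p1) * p0 = 0 by rewrite wp mulr0 mul0r.
  have -> : w0 * (w0 * p2 + w2 * p0 - 2 * w1 * p1) * p0 =
    w0 ^+ 2 * (p0 * p2 - p1 ^+ 2) + w0 * w2 * p0 ^+ 2
    + w0 ^+ 2 * p1 ^+ 2 - 2 * (w0 * p1) * (w1 * p0) by ring.
  by rewrite pp ww => <-; ring.
have /andP[] : (w0 ^+ 2 == 0) && ((w0 * p1 - w1 * p0) ^+ 2 == 0).
  by rewrite -paddr_eq0 ?sqr_ge0 // e.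
rewrite !sqrf_eq0 => /eqP w00;
  rewrite w00 mul0r sub0r oppr_eq0 mulf_eq0 (negPf p00) orbF.
move=> /eqP w10; move: wp; rewrite w00 w10 mul0r mulr0 mul0r add0r subr0 => /eqP.
by rewrite mulf_eq0 (negPf p00) orbF => /eqP.
Qed.

(* The hyperboloid model: the coordinates (1, x, x^2 + y^2) / y of a geodesic
   span a plane, in which it is a hyperbola. *)
Lemma geodesic_line_exp (c : R -> C) : geodesic_line c ->
  exists P0 Q0 P1 Q1 P2 Q2 : R, forall t,
  [/\ (Im (c t))^-1 = P0 * expR t + Q0 * expR (- t),
      Re (c t) / Im (c t) = P1 * expR t + Q1 * expR (- t) &
      (Re (c t) ^+ 2 + Im (c t) ^+ 2) / Im (c t) = P2 * expR t + Q2 * expR (- t)].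
Proof.
move=> gc; have e := geodesic_line_eq gc.
have y0 t : 0 < Im (c t) by case: gc => cH _; exact: cH.
pose v0 t := (Im (c t))^-1; pose v1 t := Re (c t) / Im (c t).
pose v2 t := (Re (c t) ^+ 2 + Im (c t) ^+ 2) / Im (c t).
have vv t : v0 t * v2 t - v1 t ^+ 2 = 1 by rewrite /v0 /v1 /v2; field;
  rewrite gt_eqF ?y0.
have v00 t : v0 t != 0 by rewrite /v0 invr_eq0 gt_eqF ?y0.
have B s t : v0 s * v2 t + v2 s * v0 t - 2 * v1 s * v1 t = expR (s - t) + expR
  (t - s).
  apply: (mulfI (lt0r_neq0 (mulr_gt0 (y0 s) (y0 t)))); rewrite -e /v0 /v1 /v2.
  by field; rewrite !gt_eqF ?y0.
rewrite -/(exists P0 Q0 P1 Q1 P2 Q2 : R, forall t,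
  [/\ v0 t = P0 * expR t + Q0 * expR (- t),
      v1 t = P1 * expR t + Q1 * expR (- t) &
      v2 t = P2 * expR t + Q2 * expR (- t)]).
clearbody v0 v1 v2.
pose k : R := expR 1; have k1 : 1 < k by rewrite expR_gt1.
have k0 : k != 0 by rewrite gt_eqF // expR_gt0.
pose S := k - k^-1; have S0 : S != 0.
  by rewrite gt_eqF // subr_gt0 (lt_trans _ k1) // invf_lt1 // expR_gt0.
(* Interpolation from times 0 and 1: sinh 1 v(t) = sinh (1 - t) v(0) + sinh t v(1), with both sides
   doubled. The coefficients of e^t and e^-t are read off from it. *)
suff H t : [/\ S * v0 t = (k * expR (- t) - k^-1 * expR t) * v0 0 + (expR t -
  expR (- t)) * v0 1,
     S * v1 t = (k * expR (- t) - k^-1 * expR t) * v1 0 + (expR t - expR (- t))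
       * v1 1 &
     S * v2 t = (k * expR (- t) - k^-1 * expR t) * v2 0 + (expR t - expR (- t))
       * v2 1].
  exists ((v0 1 - k^-1 * v0 0) / S), ((k * v0 0 - v0 1) / S).
  exists ((v1 1 - k^-1 * v1 0) / S), ((k * v1 0 - v1 1) / S).
  exists ((v2 1 - k^-1 * v2 0) / S), ((k * v2 0 - v2 1) / S) => t.
  have [h0 h1 h2] := H t.
  split; apply: (mulfI S0); [rewrite h0|rewrite h1|rewrite h2]; field;
    rewrite ?S0 ?k0 //.
set A := k * _ - _; set D := expR t - _.
(* The defect w of the interpolation is orthogonal to v(t), v(0) and v(1). Being a combination of
   them it is null, and as v(t) is timelike it vanishes. *)
set w0 := S * v0 t - A * v0 0 - D * v0 1.
set w1 := S * v1 t - A * v1 0 - D * v1 1.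
set w2 := S * v2 t - A * v2 0 - D * v2 1.
have X0 : expR t != 0 by rewrite gt_eqF // expR_gt0.
have B0t := B 0 t; have B1t := B 1 t; have B01 := B 0 1.
rewrite !(subr0, sub0r) in B0t B1t B01.
have k1t : expR (1 - t) = k * expR (- t) by rewrite expRD.
have kt1 : expR (t - 1) = k^-1 * expR t by rewrite expRD expRN mulrC.
rewrite k1t kt1 in B1t; rewrite (expRN 1) -/k in B01.
have EN : expR (- t) = (expR t)^-1 by rewrite expRN.
have wt : w0 * v2 t + w2 * v0 t - 2 * w1 * v1 t = 0.
  have -> : w0 * v2 t + w2 * v0 t - 2 * w1 * v1 t =
    2 * S * (v0 t * v2 t - v1 t ^+ 2)
    - A * (v0 0 * v2 t + v2 0 * v0 t - 2 * v1 0 * v1 t)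
    - D * (v0 1 * v2 t + v2 1 * v0 t - 2 * v1 1 * v1 t) by rewrite /w0 /w1 /w2;
      ring.
  by rewrite vv B0t B1t /A /D /S EN; field; rewrite X0 k0.
have wv0 : w0 * v2 0 + w2 * v0 0 - 2 * w1 * v1 0 = 0.
  have -> : w0 * v2 0 + w2 * v0 0 - 2 * w1 * v1 0 =
    S * (v0 0 * v2 t + v2 0 * v0 t - 2 * v1 0 * v1 t)
    - 2 * A * (v0 0 * v2 0 - v1 0 ^+ 2)
    - D * (v0 0 * v2 1 + v2 0 * v0 1 - 2 * v1 0 * v1 1) by rewrite /w0 /w1 /w2;
      ring.
  by rewrite vv B0t B01 /A /D /S EN; field; rewrite X0 k0.
have wv1 : w0 * v2 1 + w2 * v0 1 - 2 * w1 * v1 1 = 0.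
  have -> : w0 * v2 1 + w2 * v0 1 - 2 * w1 * v1 1 =
    S * (v0 1 * v2 t + v2 1 * v0 t - 2 * v1 1 * v1 t)
    - A * (v0 0 * v2 1 + v2 0 * v0 1 - 2 * v1 0 * v1 1)
    - 2 * D * (v0 1 * v2 1 - v1 1 ^+ 2) by rewrite /w0 /w1 /w2; ring.
  by rewrite vv B1t B01 /A /D /S EN; field; rewrite X0 k0.
have ww : w0 * w2 = w1 ^+ 2.
  suff : 2 * (w0 * w2 - w1 ^+ 2) = 0 by move=> ?; lra.
  transitivity (S * (w0 * v2 t + w2 * v0 t - 2 * w1 * v1 t)
    - A * (w0 * v2 0 + w2 * v0 0 - 2 * w1 * v1 0)
    - D * (w0 * v2 1 + w2 * v0 1 - 2 * w1 * v1 1)); last by rewrite wt wv0 wv1;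
      ring.
  by rewrite /w0 /w1 /w2; ring.
have [e0 e1 e2] := null_orthogonal_timelike (v00 t) (vv t) ww wt.
by split; apply/eqP; rewrite -subr_eq0 opprD addrA; apply/eqP.
Qed.

Lemma geodesic_line_rev (c : R -> C) :
  geodesic_line c -> geodesic_line (fun t => c (- t)).
Proof.
move=> [cH cd]; split=> [t|s t]; first exact: cH.
by rewrite cd -opprD normrN.
Qed.

Lemma cvg_sphere_rev (c : R -> C) (p : option C) :
  cvg_sphere c (ninfty_nbhs R) p -> cvg_sphere (fun t => c (- t)) (pinfty_nbhs R) p.
Proof.
case: p => [a|] /=.
  by move=> [h1 h2]; split; [have/cvgNy_compNP := h1|have/cvgNy_compNP := h2].
by move=> h; have/cvgNy_compNP := h.
Qed.

(** Divided by the height, [q] is linear in hyperboloid coordinates, hence A e^r + B e^-r along [c].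
    Its sign is that of A (e^r)^2 + B, which is monotone in r. *)
Lemma geodesic_quadratic_sign (c : R -> C) (k0 k1 k2 : R) (s u t : R) :
  geodesic_line c -> s <= u <= t ->
  let q z := k0 + k1 * Re z + k2 * (Re z ^+ 2 + Im z ^+ 2) in
  0 <= q (c s) -> 0 <= q (c t) -> 0 <= q (c u).
Proof.
move=> gc /andP[su ut] q.
have y0 r : 0 < Im (c r) by case: gc => cH _; exact: cH.
have [P0 [Q0 [P1 [Q1 [P2 [Q2 H]]]]]] := geodesic_line_exp gc.
pose A := k0 * P0 + k1 * P1 + k2 * P2; pose B := k0 * Q0 + k1 * Q1 + k2 * Q2.
have qE r : (0 <= q (c r)) = (0 <= A * expR r ^+ 2 + B).
  have [h0 h1 h2] := H r.
  have -> : A * expR r ^+ 2 + B = q (c r) / Im (c r) * expR r.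
    have -> : q (c r) / Im (c r) = k0 * (Im (c r))^-1 + k1 * (Re (c r) / Im (c r))
        + k2 * ((Re (c r) ^+ 2 + Im (c r) ^+ 2) / Im (c r)).
      by rewrite /q; field; rewrite gt_eqF ?y0.
    by rewrite h2 h1 h0 expRN /A /B; field; rewrite gt_eqF ?expR_gt0.
  by rewrite pmulr_lge0 ?expR_gt0 // pmulr_lge0 // invr_gt0.
rewrite !qE.
have : expR s ^+ 2 <= expR u ^+ 2 by rewrite ler_sqr ?nnegrE ?expR_ge0 // ler_expR.
have : expR u ^+ 2 <= expR t ^+ 2 by rewrite ler_sqr ?nnegrE ?expR_ge0 // ler_expR.
by have [A0|A0] := lerP 0 A; nra.
Qed.

(** Escape to infinity kills the e^t coefficients of 1/y and of x/y, so x is constant and y a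
    multiple of e^t. *)
Lemma geodesic_to_infty (c : R -> C) (s u : R) : geodesic_line c ->
  cvg_sphere c (pinfty_nbhs R) None -> s <= u ->
  Re (c u) = Re (c s) /\ Im (c s) <= Im (c u).
Proof.
move=> gc coo su.
have y0 r : 0 < Im (c r) by case: gc => cH _; exact: cH.
have [P0 [Q0 [P1 [Q1 [P2 [Q2 H]]]]]] := geodesic_line_exp gc.
have lim_ge0 (a b : R) : (\forall t \near +oo, 0 <= a * expR t + b * expR (-
  t)) -> 0 <= a.
  move=> ab; rewrite leNgt; apply/negP => a0.
  (* Once e^-t is below this threshold, a + b e^(-2t) is negative, a contradiction. *)
  have e0 : 0 < Num.min 1 (- a / (`|b| + 1)).
    by rewrite lt_min ltr01 divr_gt0 ?oppr_gt0 // ltr_wpDl.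
  have /filter_ex[t [h1 h2]] :
    \forall t \near +oo, 0 <= a * expR t + b * expR (- t) /\
      expR (- t) < Num.min 1 (- a / (`|b| + 1)).
    by near=> t; split; near: t => //; exact: cvgr_lt (@cvgr_expR R) _ e0.
  move: h2; rewrite lt_min => /andP[t1]; rewrite ltr_pdivlMr ?ltr_wpDl // => t2.
  have X0 := expR_gt0 (- t);
    have XX : expR t * expR (- t) = 1 by rewrite expRxMexpNx_1.
  have {}h1 : 0 <= (a * expR t + b * expR (- t)) * expR (- t) by rewrite
    mulr_ge0 // ltW.
  have b1 : b <= `|b| := ler_norm b.
  have : 0 <= a + b * (expR (- t) * expR (- t)).
    have <- : (a * expR t + b * expR (- t)) * expR (- t) = a + b * (expR (- t)
      * expR (- t)).
      by rewrite mulrDl -mulrA XX; ring.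
    by [].
  have : expR (- t) * expR (- t) <= expR (- t) by nra.
  have : 0 <= `|b| by [].
  nra.
have P0_ge0 : 0 <= P0.
  by apply: (@lim_ge0 _ Q0); near=> t; have [<- _ _] := H t; rewrite invr_ge0 ltW.
have P0E : P0 = 0.
  apply/eqP; rewrite eq_le P0_ge0 andbT leNgt; apply/negP => P0_gt0.
  (* If [P0 > 0], then |c t|^2 is bounded near [+oo]; this [M] makes the leading coefficient
     [P2 - M * P0] equal to -1. *)
  pose M := (P2 + 1) / P0.
  suff : 0 <= P2 - M * P0 by rewrite /M divfK ?gt_eqF //; lra.
  apply: (@lim_ge0 _ (Q2 - M * Q0)); near=> t; have [h0 _ h2] := H t.
  have -> : (P2 - M * P0) * expR t + (Q2 - M * Q0) * expR (- t) =
    (Re (c t) ^+ 2 + Im (c t) ^+ 2 - M) / Im (c t).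
    by rewrite [RHS]mulrBl h2 h0; ring.
  rewrite divr_ge0 ?(ltW (y0 t)) // subr_ge0; near: t.
  exact: cvgry_ge coo M.
have P1E : P1 = 0.
  have e t : (Q0 * P2 - 2 * P1 * Q1) * expR t ^+ 2 + (Q0 * Q2 - Q1 ^+ 2)
      - P1 ^+ 2 * (expR t ^+ 2) ^+ 2 = expR t ^+ 2.
    have [h0 h1 h2] := H t.
    have : (Im (c t))^-1 * ((Re (c t) ^+ 2 + Im (c t) ^+ 2) / Im (c t))
      - (Re (c t) / Im (c t)) ^+ 2 = 1 by field; rewrite gt_eqF ?y0.
    rewrite h2 h1 h0 P0E expRN => /(congr1 (fun v => v * expR t ^+ 2)).
    by rewrite mul1r => e; rewrite -[RHS]e; field; rewrite gt_eqF ?expR_gt0.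
  (* A quadratic identity in X = e^(2t), tested at X = 1, 4, 9, so the coefficient [P1 ^+ 2] of X^2
     vanishes. *)
  have := (e 0, e (ln 2), e (ln 3)); rewrite expR0 !lnK ?posrE // => -[[e1 e2] e3].
  by apply/eqP; rewrite -sqrf_eq0; apply/eqP; lra.
have h r : (Im (c r))^-1 = Q0 * expR (- r) /\ Re (c r) / Im (c r) = Q1 * expR (- r).
  by have [-> -> _] := H r; rewrite P0E P1E !mul0r !add0r.
have Q0_gt0 : 0 < Q0.
  by have [e _] := h 0; rewrite oppr0 expR0 mulr1 in e; rewrite -e invr_gt0.
have yE r : Im (c r) = expR r / Q0.
  by have [e _] := h r; rewrite -[LHS]invrK e expRN invfM invrK mulrC.
have xE r : Re (c r) = Q1 / Q0.
  have [_ e] := h r; rewrite -[LHS](divfK (lt0r_neq0 (y0 r))) e yE expRN.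
  by field; rewrite !gt_eqF ?expR_gt0.
by rewrite !xE !yE; split=> //; rewrite ler_pM2r ?invr_gt0 // ler_expR.
Unshelve. all: by end_near. Qed.

(** Near an interior point the distance to [c 0] stays bounded, while along the geodesic it is t. *)
Lemma geodesic_not_to_point (c : R -> C) (a : C) : geodesic_line c -> 0 < Im a ->
  ~ cvg_sphere c (pinfty_nbhs R) (Some a).
Proof.
move=> gc a0 [cx cy].
have y0 r : 0 < Im (c r) by case: gc => cH _; exact: cH.
have [M HM] : exists M : R, \forall t \near +oo, expR t <= M.
  (* [D] bounds the left side of [geodesic_line_eq] once [c t] is within 1 of [a] in real part and
     below [Im a + 1] in height. *)
  pose D := (Re (c 0) - Re a - 1) ^+ 2 + (Re (c 0) - Re a + 1) ^+ 2
    + Im (c 0) ^+ 2 + (Im a + 1) ^+ 2.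
  exists (D / (Im (c 0) * (Im a / 2))).
  near=> t; rewrite ler_pdivlMr ?mulr_gt0 ?divr_gt0 // ?y0 //.
  have x1 : Re (c t) < Re a + 1 by near: t; apply: (cvgr_lt _ cx); rewrite ltrDl.
  have x2 : Re a - 1 < Re (c t) by near: t; apply: (cvgr_gt _ cx);
    rewrite ltrBlDr ltrDl.
  have y1 : Im (c t) < Im a + 1 by near: t; apply: (cvgr_lt _ cy); rewrite ltrDl.
  have y2 : Im a / 2 < Im (c t) by near: t; apply: (cvgr_gt _ cy); lra.
  have := geodesic_line_eq gc 0 t; rewrite subr0 sub0r => e.
  have Xt := expR_gt0 t; have Xt' := expR_gt0 (- t).
  have yc := y0 0.
  have step : expR t * (Im (c 0) * (Im a / 2)) <=
      Im (c 0) * Im (c t) * (expR (- t) + expR t).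
    have h1 : Im (c 0) * (Im a / 2) <= Im (c 0) * Im (c t) by rewrite ler_pM2l
      // ltW.
    rewrite mulrC ler_pM // ?mulr_ge0 ?divr_ge0 //; lra.
  apply: (le_trans step); rewrite -e /D.
  have : Im (c t) ^+ 2 <= (Im a + 1) ^+ 2 by rewrite ler_sqr ?nnegrE; lra.
  have : 0 <= (Re (c t) - Re a + 1) * (Re a + 1 - Re (c t)) by rewrite
    mulr_ge0; lra.
  have := sqr_ge0 (Re (c 0) - Re (c t) - 2 * (Re (c 0) - Re a)); lra.
have /filter_ex[t [h1 h2]] : \forall t \near +oo, expR t <= M /\ M < t.
  by near=> t; split; near: t => //; apply: nbhs_pinfty_gt; rewrite num_real.
by have := expR_ge1Dx t; lra.
Unshelve. all: by end_near. Qed.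

(** The height would be monotone in both directions, so [c 0 = c 1], although their distance is
    1. *)
Lemma geodesic_not_infty_infty (c : R -> C) : geodesic_line c ->
  cvg_sphere c (pinfty_nbhs R) None -> ~ cvg_sphere c (ninfty_nbhs R) None.
Proof.
move=> gc cp /cvg_sphere_rev cn.
have [x1 y1] := geodesic_to_infty gc cp ler01.
have N10 : - 1 <= (0 : R) by rewrite lerN10.
have [_] := geodesic_to_infty (geodesic_line_rev gc) cn N10.
rewrite opprK oppr0 => y2; have y12 : Im (c 1) = Im (c 0) by apply/eqP;
  rewrite eq_le y1 y2.
have y0 : 0 < Im (c 0) by case: gc => cH _; exact: cH.
have := geodesic_line_eq gc 0 1; rewrite x1 y12 subr0 sub0r => e.
have : Im (c 0) * Im (c 0) * (expR (- 1) + expR 1 - 2) = 0 by rewrite mulrBr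
  -e; ring.
move/eqP; rewrite !mulf_eq0 (gt_eqF y0) /= => /eqP {}e.
have k1 : 1 < expR (1 : R) by rewrite expR_gt1.
have XX : expR (1 : R) * expR (- 1) = 1 by rewrite expRxMexpNx_1.
have : (expR (1 : R) - 1) ^+ 2 = 0.
  transitivity (expR (1:R) * (expR (- 1) + expR 1 - 2) + 1 - expR (1 : R) *
    expR (- 1)); first by ring.
  by rewrite e XX mulr0 add0r subrr.
by move/eqP; rewrite sqrf_eq0 subr_eq0 gt_eqF.
Qed.

End geodesics_of_the_half_plane.

(** * The domain as a geodesic convex hull *)

Section domain.
Variable R : realType.
Local Notation C := R[i].

Let F : set C := [set z | [/\ H2 z, 0 <= Re z <= 2 &
                              2 <= Im z ^+ 2 + (Re z - 1) ^+ 2]].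

Lemma geodesically_convex_domain : geodesically_convex (Some @` F `|` [set None]).
Proof.
have segment c s u t : geodesic_line c -> s <= u <= t -> F (c s) -> F (c t) ->
  F (c u).
  move=> gc sut [_ /andP[xs xs'] zs] [_ /andP[xt xt'] zt].
  (* The three sides are the forms x, 2 - x and |z - 1|^2 - 2, the last with coefficients -1, -2,
     1. *)
  have Q k0 k1 k2 := @geodesic_quadratic_sign R c k0 k1 k2 s u t gc sut.
  split; first by case: gc => cH _; exact: cH.
    have := Q 0 1 0; have := Q 2 (-1) 0.
    by move=> h1 h2; apply/andP; split; [move: h2|move: h1] => /=; lra.
  have := Q (-1) (-2) 1 => /= h;
    suff : 0 <= -1 + -2 * Re (c u) + 1 * (Re (c u) ^+ 2 + Im (c u) ^+ 2) by nra.
  by apply: h; nra.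
have ray c s u : geodesic_line c -> cvg_sphere c (pinfty_nbhs R) None -> s <= u ->
    F (c s) -> F (c u).
  move=> gc coo su [ys xs zs]; have [xE yle] := geodesic_to_infty gc coo su.
  rewrite /H2 /= in ys.
  by split; rewrite /H2 /= ?xE //; [exact: lt_le_trans yle|nra].
have at_infty c p : geodesic_line c -> cvg_sphere c (pinfty_nbhs R) p ->
    (Some @` F `|` [set None]) p -> p = None.
  move=> gc cp [[a [aH _ _] aE]|//]; rewrite -aE in cp.
  by have := geodesic_not_to_point gc aH cp.
split=> [p [[z [zH _ _] <-]|->//]|]; first exact: ltW.
move=> c s t p q gc cs ct Kp Kq u /andP[su ut].
have gr := geodesic_line_rev gc.
suff Fu : F (c u) by left; exists (c u).
(* The bounds on [u] leave [s] finite or [-oo] and [t] finite or [+oo]. An infinite time forces the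
   endpoint [None]; [-oo] is handled by time reversal, and both being infinite is impossible. *)
case: s t cs ct su ut => [s| |] [t| |] //= cs ct su ut.
- rewrite !lee_fin in su ut.
  case: Kp => [[z Fz zE]|pE]; last by rewrite pE in cs.
  case: Kq => [[w Fw wE]|qE]; last by rewrite qE in ct.
  move: zE wE; rewrite cs ct => -[zE] [wE]; rewrite zE in Fz; rewrite wE in Fw.
  by apply: (segment c s u t) => //; rewrite su.
- rewrite lee_fin in su.
  case: Kp => [[z Fz zE]|pE]; last by rewrite pE in cs.
  move: zE; rewrite cs => -[zE]; rewrite zE in Fz.
  by have qE := at_infty c q gc ct Kq; rewrite qE in ct; exact: ray gc ct su Fz.
- rewrite lee_fin in ut.
  case: Kq => [[w Fw wE]|qE]; last by rewrite qE in ct.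
  move: wE; rewrite ct => -[wE]; rewrite wE in Fw.
  have cs' := cvg_sphere_rev cs.
  have pE := at_infty _ p gr cs' Kp; rewrite pE in cs'.
  have := @ray (fun r => c (- r)) (- t) (- u) gr cs'; rewrite !opprK.
  by apply; rewrite ?lerN2.
- have cs' := cvg_sphere_rev cs.
  have qE := at_infty c q gc ct Kq; have pE := at_infty _ p gr cs' Kp.
  rewrite qE in ct; rewrite pE in cs.
  by have := geodesic_not_infty_infty gc ct cs.
Qed.

Lemma vertical_geodesic (x y : R) : 0 < y -> geodesic_line (fun t => x +i* (y *
  expR t)).
Proof.
move=> y0; apply: geodesic_line_criterion => [t|s t] /=;
  first by rewrite mulr_gt0 ?expR_gt0.
rewrite !expRD !expRN; field; rewrite ?gt_eqF ?expR_gt0 //.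
Qed.

Lemma vertical_geodesic_infty (x y : R) : 0 < y ->
  cvg_sphere (fun t => x +i* (y * expR t)) (pinfty_nbhs R) None.
Proof.
move=> y0; apply/cvgryPge => A; near=> t => /=.
have t1 : 0 <= t by near: t; apply: nbhs_pinfty_ge; rewrite num_real.
have tA : A / y ^+ 2 <= t by near: t; apply: nbhs_pinfty_ge; rewrite num_real.
rewrite ler_pdivrMr ?exprn_gt0 // in tA.
rewrite (le_trans tA) // exprMn mulrC.
have e1 := expR_ge1Dx t.
have : t * y ^+ 2 <= expR t ^+ 2 * y ^+ 2 by rewrite ler_wpM2r ?sqr_ge0 //; nra.
have := sqr_ge0 x; lra.
Unshelve. all: by end_near. Qed.

(* The parametrization m + r tanh t + i r / cosh t of a half-circle. *)
Lemma circle_geodesic (m r : R) : 0 < r ->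
  geodesic_line (fun t => (m + r * ((expR t ^+ 2 - 1) / (expR t ^+ 2 + 1)))
                  +i* (r * (2 * expR t / (expR t ^+ 2 + 1)))).
Proof.
have D0 t : 0 < expR t ^+ 2 + 1 :> R by rewrite ltr_wpDl ?sqr_ge0.
move=> r0; apply: geodesic_line_criterion => [t|s t] /=.
  by rewrite mulr_gt0 // divr_gt0 // mulr_gt0 // expR_gt0.
rewrite !expRD !expRN; field.
by rewrite !gt_eqF ?D0 ?expR_gt0.
Qed.

Lemma domain_sub_convex (S : set (option C)) : geodesically_convex S ->
  S (Some (0 +i* 1)) -> S (Some (2 +i* 1)) -> S None -> Some @` F `<=` S.
Proof.
move=> [_ cS] Si S2i Soo _ [[x y] [/= y0 /andP[x0 x2] hz] <-]; rewrite /H2 /= in y0.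
pose r : R := Num.sqrt 2.
have r2 : r ^+ 2 = 2 by rewrite sqr_sqrtr.
have r0 : 0 < r by rewrite sqrtr_gt0.
have r1 : 1 < r by rewrite -(@ltr_sqr R) ?nnegrE ?ltW // r2 expr1n; lra.
have r22 : r < 2 by rewrite -(@ltr_sqr R) ?nnegrE ?ltW // r2 expr2; lra.
pose c t : C := (1 + r * ((expR t ^+ 2 - 1) / (expR t ^+ 2 + 1)))
                  +i* (r * (2 * expR t / (expR t ^+ 2 + 1))).
have gc : geodesic_line c := circle_geodesic 1 r0.
pose E : R := (r + (x - 1)) / (r - (x - 1)).
(* [E] solves tanh u = (x - 1) / r for e^(2u), so that [c u] is the point of the arc below the given
   point. *)
have d0 : 0 < r - (x - 1) by lra.
have n0 : 0 < r + (x - 1) by lra.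
have E0 : 0 < E by rewrite divr_gt0.
pose u := ln (Num.sqrt E).
have eu : expR u ^+ 2 = E by rewrite lnK ?posrE ?sqrtr_gt0 // sqr_sqrtr // ltW.
have xu : Re (c u) = x.
  by rewrite /= eu /E; field; rewrite !gt_eqF //=; lra.
have yu0 : 0 < Im (c u) by case: gc => cH _; exact: cH.
have yu : Im (c u) ^+ 2 + (x - 1) ^+ 2 = 2.
  have : Im (c u) ^+ 2 + (Re (c u) - 1) ^+ 2 = r ^+ 2.
    by rewrite /=; field; rewrite gt_eqF // ltr_wpDl ?sqr_ge0.
  by rewrite xu r2.
have Scu : S (Some (c u)).
  have s0 : 0 < r - 1 by lra.
  have t0 : 0 < r + 1 by lra.
  (* Since (r - 1)(r + 1) = 1, tanh is -1/r and 1/r at these times, where the arc passes through i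
     and 2 + i. *)
  apply: (cS c (ln (r - 1))%:E (ln (r + 1))%:E (Some (0 +i* 1)) (Some (2 +i*
    1))) => //=.
  - congr Some; rewrite /c lnK ?posrE //; apply/eqP; rewrite eq_complex /=.
    have -> : (r - 1) ^+ 2 + 1 = 2 * r * (r - 1) by lra.
    have -> : (r - 1) ^+ 2 - 1 = 2 - 2 * r by lra.
    by apply/andP; split; apply/eqP; field; rewrite !gt_eqF.
  - congr Some; rewrite /c lnK ?posrE //; apply/eqP; rewrite eq_complex /=.
    have -> : (r + 1) ^+ 2 + 1 = 2 * r * (r + 1) by lra.
    have -> : (r + 1) ^+ 2 - 1 = 2 + 2 * r by lra.
    by apply/andP; split; apply/eqP; field; rewrite !gt_eqF.
  (* After squaring, the bounds on [E] amount to x (2 - r) >= 0 and (2 - x)(2 + r) >= 0. *)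
  - rewrite !lee_fin !ler_ln ?posrE ?sqrtr_gt0 //.
    rewrite -(@ler_sqr R (r - 1)) ?nnegrE ?sqrtr_ge0 ?(ltW s0) //.
    rewrite -(@ler_sqr R _ (r + 1)) ?nnegrE ?sqrtr_ge0 ?(ltW t0) //.
    rewrite sqr_sqrtr ?(ltW E0) // /E ler_pdivlMr // ler_pdivrMr //.
    have -> : (r - 1) ^+ 2 = 3 - 2 * r by lra.
    have -> : (r + 1) ^+ 2 = 3 + 2 * r by lra.
    have : 0 <= x * (2 - r) by rewrite mulr_ge0 // subr_ge0 ltW.
    have : 0 <= (2 - x) * (2 + r) by rewrite mulr_ge0 // ?subr_ge0 // addr_ge0
      // ltW.
    by move=> ? ?; apply/andP; split; lra.
have yy : Im (c u) <= y.
  rewrite -(@ler_sqr R) ?nnegrE ?(ltW y0) ?(ltW yu0) //; lra.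
have gv := vertical_geodesic x yu0; have vo := @vertical_geodesic_infty x _ yu0.
have w0 : 1 <= y / Im (c u) by rewrite ler_pdivlMr // mul1r.
(* The vertical ray from [c u] reaches height [y] at this time, nonnegative because
   [Im (c u) <= y]. *)
have := cS _ 0%:E +oo%E (Some (c u)) None gv _ vo Scu Soo (ln (y / Im (c u))).
have -> : Im (c u) * expR (ln (y / Im (c u))) = y.
  by rewrite lnK ?posrE ?divr_gt0 // mulrC divfK // gt_eqF.
apply; last by rewrite lee_fin ln_ge0 // leey.
by rewrite /geodesic_at expR0 mulr1 -[in RHS]xu.
Qed.

Lemma convex_hull_domain :
  convex_hull [set Some (0 +i* 1); Some (2 +i* 1); None] = Some @` F `|` [set None].
Proof.
apply/seteqP; split.
  apply: smallest_sub; first exact: geodesically_convex_domain.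
  move=> p [[->|->]|->]; [left|left|right] => //; eexists; try reflexivity.
    by split; rewrite /H2 /= ?ltr01 //; lra.
  by split; rewrite /H2 /= ?ltr01 //; lra.
move=> p Kp S [convS sub].
have Soo : S None by apply: sub; right.
case: Kp => [Fp|->//]; apply: domain_sub_convex p Fp => //; apply: sub; left;
  [left|right] => //.
Qed.

End domain.

Theorem lemma1p3p2p9 (R : realType) :
  let G_R : set R := [set` `[0, 2]] in
  [/\ (* (a) *)
      @height_stabilizer R =
        [set g | exists n : int, g = mx2 1 (2 * n%:~R) 0 1 \/
                                 g = - mx2 1 (2 * n%:~R) 0 1],
      (* (b) *)
      fundamental_domain (@height_stabilizer R) (@induced_act R) G_R,
      G_R = closure (interior G_R),
      (* (c) *)
      F_R G_R = [set z | [/\ H2 z, 0 <= complex.Re z <= 2 &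
                            2 <= complex.Im z ^+ 2 + (complex.Re z - 1) ^+ 2]] &
      convex_hull [set Some (0 +i* 1); Some (2 +i* 1); None] =
        Some @` F_R G_R `|` [set None]].
Proof.
move=> G_R; have FE : F_R G_R = _ := F_RE R.
split; [exact: height_stabilizerE|exact: fundamental_domain_itv02
       |exact: closure_interior_itv02|exact: FE|].
by rewrite FE; exact: convex_hull_domain.
Qed.
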